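(* Consider the online hiring problem with costs drawn i.i.d. from the uniform distribution $U[0,1]$. The following online algorithm (Algorithm 1) is strictly $8.122$-competitive. Initialize $\tau\leftarrow 1$ and $t\leftarrow 1$. For $i=1,\dots,n$: set $t\leftarrow t-1$; if $x_i\le\tau$, hire applicant $i$ for $4/\tau$ time steps, and if $i+4/\tau>n$ stop, otherwise set $\tau\leftarrow\tau/2$ and $t\leftarrow 1/\tau$; else, if $t=0$, set $\tau\leftarrow 2\tau$ and $t\leftarrow 1/\tau$.
   Context: Online hiring problem: there are $n$ time steps; in time step $i$ applicant $i$ arrives and its cost $x_i$ is revealed, where $x_1,\dots,x_n$ are drawn independently from a distribution $X$. Immediately and irrevocably at time $i$, based only on $x_1,\dots,x_i$ and earlier decisions, the algorithm chooses a nonnegative integer duration $t_i$; applicant $i$ is then under contract during time steps $i,\dots,i+t_i-1$. At every time step $s\in\{1,\dots,n\}$ at least one applicant must be under contract. The cost is $\sum_i t_ix_i$; $\textsc{Alg}_n$ denotes the cost of the online algorithm and $\textsc{Opt}_n$ the minimum cost of a feasible solution knowing all $x_1,\dots,x_n$ in advance. An online algorithm is strictly $c$-competitive if $\sup_{n\in\mathbb{N}}\mathbf{E}[\textsc{Alg}_n]/\mathbf{E}[\textsc{Opt}_n]\le c$. *)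

(* Defs.v *)
From HB Require Import structures.
From mathcomp Require Import all_boot all_order all_algebra.
From mathcomp Require Import all_classical all_reals all_analysis.

Set Implicit Arguments.
Unset Strict Implicit.
Unset Printing Implicit Defensive.

Import Order.TTheory GRing.Theory Num.Theory.
Import numFieldNormedType.Exports.

Local Open Scope classical_set_scope.
Local Open Scope ring_scope.

(* Applicants and time steps 1, ..., n are numbered 0, ..., n - 1 by 'I_n.    *)
(* Durations are real numbers, required to be nonnegative integers in         *)
(* [feasible].                                                                *)

Section Hiring.
Context {R : realType}.

Definition cost (n : nat) (x t : 'I_n -> R) : R := \sum_(i < n) t i * x i.

Definition feasible (n : nat) (t : 'I_n -> R) : Prop :=
  (forall i, t i \is a Num.nat) /\
  (forall s : 'I_n, exists i : 'I_n, (i <= s)%N /\ s%:R < i%:R + t i).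

(* For nonnegative costs the infimum is attained. *)
Definition opt (n : nat) (x : 'I_n -> R) : R :=
  inf [set cost x t | t in @feasible n].

(* [A n x i] is the duration chosen for applicant [i]. As [A] is              *)
(* deterministic, the earlier decisions are functions of the earlier costs.   *)
Definition online_algorithm (S : set R)
    (A : forall n : nat, ('I_n -> R) -> 'I_n -> R) : Prop :=
  forall n : nat,
    (forall (x y : 'I_n -> R) (i : 'I_n),
       (forall j : 'I_n, (j <= i)%N -> x j = y j) -> A n x i = A n y i) /\
    (forall x : 'I_n -> R, (forall i, S (x i)) -> feasible (A n x)).

(* Durations chosen for the applicants i, i + 1, ... (numbered from 1) with   *)
(* costs [xs], where [tau] and [t] are the values of the variables of the     *)
(* algorithm at the beginning of iteration [i].                               *)
Fixpoint hire_from (n i : nat) (tau t : R) (xs : seq R) : seq R :=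
  if xs is x :: xs' then
    let t' := t - 1 in
    if x <= tau then
      4 / tau ::
        (if n%:R < i%:R + 4 / tau then nseq (size xs') 0
         else let tau' := tau / 2 in hire_from n i.+1 tau' (1 / tau') xs')
    else
      0 :: (if t' == 0 then
              let tau' := 2 * tau in hire_from n i.+1 tau' (1 / tau') xs'
            else hire_from n i.+1 tau t' xs')
  else [::].

Definition algorithm1 (n : nat) (x : 'I_n -> R) (i : 'I_n) : R :=
  nth 0 (hire_from n 1 1 1 (codom x)) i.

Definition mutually_independent (d : measure_display) (T : measurableType d)
    (P : probability T R) (I : finType) (X : I -> {RV P >-> R}) : Prop :=
  forall (J : {set I}) (B : I -> set R), (forall i, measurable (B i)) ->
    P (\bigcap_(i in [set` J]) (X i @^-1` B i)) =
    (\prod_(i in J) P (X i @^-1` B i))%E.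

Definition iid_uniform01 (d : measure_display) (T : measurableType d)
    (P : probability T R) (I : finType) (X : I -> {RV P >-> R}) : Prop :=
  mutually_independent X /\
  forall (i : I) (B : set R), measurable B ->
    distribution P (X i) B = uniform_prob (@ltr01 R) B.

(* [X n] is the cost sequence of the instance with [n] time steps. *)
Definition strictly_competitive (d : nat -> measure_display)
    (T : forall n, measurableType (d n)) (P : forall n, probability (T n) R)
    (X : forall n, 'I_n -> {RV (P n) >-> R}) (c : R)
    (A : forall n : nat, ('I_n -> R) -> 'I_n -> R) : Prop :=
  (ereal_sup [set 'E_(P n)[fun w => cost (X n ^~ w) (A n (X n ^~ w))]
                  / 'E_(P n)[fun w => opt (X n ^~ w)]
             | n in [set n | (0 < n)%N]]
   <= c%:E)%E.

End Hiring.

(* Main.v *)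
Require Import Defs.
From mathcomp Require Import all_boot all_order all_algebra.
From mathcomp Require Import all_classical all_reals all_analysis.
From mathcomp Require Import measurable_realfun ring lra zify.

Set Implicit Arguments.
Unset Strict Implicit.
Unset Printing Implicit Defensive.

Import Order.TTheory GRing.Theory Num.Theory.
Import numFieldNormedType.Exports.

Local Open Scope classical_set_scope.
Local Open Scope ring_scope.

(* A hire at threshold tau = 2^-k costs (4 / tau) * (tau / 2) = 2 on average,  *)
(* and a phase of length 2^k at this threshold ends without a hire with        *)
(* probability (1 - 2^-k)^(2^k) <= 1/e <= 3/8. The level k is thus a random    *)
(* walk with upward drift, and as a hire at level K ends the run when          *)
(* n <= 4 * 2^K, a potential that is linear in K - k bounds the expected cost  *)
(* of the algorithm by 5 K + 2. The optimum pays at least the running minimum  *)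
(* in every step, so its expectation is at least 1/2 + ... + 1/(n + 1), which  *)
(* grows by more than 5 / 8.122 each time n doubles, once n > 16.              *)

(** The slope 5 is dictated by the failure probability 3/8. If a fresh phase at level k is valued at
    5 (K + 1 - k), then a hire worth 2 followed by level k + 1, against a failure followed by level
    k - 1, breaks even exactly when failure has probability 3/8. [exprB1V_le] supplies this
    probability, [hire_potential] refines the value inside a phase, and [integral_hire_cost_le]
    carries the induction over the applicants that gives [expected_algorithm1_le]. On the other
    side, [cost_ge_sum_lower] charges each step to an applicant covering it, and [expected_opt_ge]
    evaluates the resulting bound through the expected minimum 1/(s + 2) of s + 1 uniform costs. For
    the least K with n <= 4 * 2^K, [harmonic_lower] compares the two sides. Feasibility
    ([hire_from_covers]) holds because a contract of length 4 * 2^k outlasts the wait for the next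
    hire, which is at most a geometric sum of phase lengths. *)

Section Deterministic.
Context {R : realType}.
Implicit Types (tau t x : R) (xs ys : seq R) (n i k r : nat).

Lemma nth_hire_from_causal n m i tau t xs ys :
  size xs = size ys -> take m.+1 xs = take m.+1 ys ->
  nth 0 (hire_from n i tau t xs) m = nth 0 (hire_from n i tau t ys) m.
Proof.
elim: xs ys m i tau t => [|x xs IH] [|y ys] // m i tau t [es] /= [<- etake].
case: ifP => _; case: m etake => [|m] //= etake.
  by case: ifP => _; [rewrite es|exact: IH].
by case: ifP => _; exact: IH.
Qed.

Lemma expr2V k : (2 ^- k : R) / 2 = 2 ^- k.+1.
Proof. by rewrite exprSr invfM. Qed.

Lemma mul2_expr2V k : 2 * (2 ^- k.+1 : R) = 2 ^- k.
Proof. by rewrite exprS invfM mulrA divff ?mul1r. Qed.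

Lemma expr2V_gt0 k : 0 < (2 ^- k : R).
Proof. by rewrite invr_gt0 exprn_gt0. Qed.

Lemma expr2V_le1 k : (2 ^- k : R) <= 1.
Proof. by rewrite invf_le1 ?exprn_gt0// exprn_ege1// ler1n. Qed.

Lemma div_expr2V c k : (c / 2 ^- k : R) = c * 2 ^+ k.
Proof. by rewrite invrK. Qed.

Lemma div1_expr2V k : (1 / 2 ^- k : R) = (2 ^ k)%:R.
Proof. by rewrite div1r invrK natrX. Qed.

(** On reachable states the tests become comparisons of natural numbers. The doubled threshold stays
    unreduced because at k = 0 it is no negative power of 2; costs at most 1 exclude that branch. *)
Lemma hire_from_cons n i k r x xs :
  hire_from n i (2 ^- k) r.+1%:R (x :: xs) =
  if x <= 2 ^- k then
    (4 * 2 ^ k)%:R ::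
      (if (n < i + 4 * 2 ^ k)%N then nseq (size xs) 0
       else hire_from n i.+1 (2 ^- k.+1) (2 ^ k.+1)%:R xs)
  else
    0 :: (if r is 0 then hire_from n i.+1 (2 * 2 ^- k) (1 / (2 * 2 ^- k)) xs
          else hire_from n i.+1 (2 ^- k) r%:R xs).
Proof.
rewrite /= !div_expr2V expr2V -[r.+1%:R]natr1 addrK.
rewrite -natrX -natrM -natrD ltr_nat pnatr_eq0 div1_expr2V.
by case: r.
Qed.

Lemma hire_from_nat n i k r xs m :
  (0 < r)%N -> all (<= 1) xs ->
  nth 0 (hire_from n i (2 ^- k) r%:R xs) m \is a Num.nat.
Proof.
elim: xs k r m i => [|x xs IH] k [//|r] m i _; first by rewrite nth_nil.
move=> /andP[x1 xs1]; rewrite /= in x1; rewrite hire_from_cons; case: ifPn => [_|xk].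
  case: m => [|m] //=; case: ifP => _; first by rewrite nth_nseq if_same.
  by apply: IH; rewrite ?expn_gt0.
case: m => [|m] //=.
case: r => [|r]; last exact: IH.
(* At level 0 the threshold is 1, so no cost in the unit interval is rejected. *)
case: k xk => [|k] xk; first by rewrite expr0 invr1 x1 in xk.
by rewrite mul2_expr2V div1_expr2V; apply: IH; rewrite ?expn_gt0.
Qed.

(* From the state [tau = 2 ^- k], [t = r] a hire happens at the latest after  *)
(* r - 1 + 2^(k-1) + ... + 1 further steps, which is why the guarantee starts *)
(* at that offset.                                                            *)
Lemma hire_from_covers n i k r xs s :
  (0 < r)%N -> all (<= 1) xs -> (size xs + i = n.+1)%N ->
  (r + 2 ^ k <= s + 2)%N -> (s < size xs)%N ->
  exists j, (j <= s)%N /\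
    s%:R < j%:R + nth 0 (hire_from n i (2 ^- k) r%:R xs) j.
Proof.
elim: xs k r i s => [//|x xs IH] k [//|r] i s _ /andP[x1 xs1] szx ge_s lt_s.
rewrite /= in x1 szx lt_s.
have k0 : (0 < 2 ^ k)%N by rewrite expn_gt0.
rewrite hire_from_cons; case: ifPn => [_|xk].
  have [sk|ks] := ltnP s (4 * 2 ^ k).
    by exists 0%N; split=> //=; rewrite add0r ltr_nat.
  case: ifPn => [stop|_]; first lia.
  (* This is where the factor 4 enters: level k + 1 guarantees coverage from offset 2 * 2^(k+1) - 2
     on, and the current contract lasts until then. *)
  have [|||||j [js sj]] := IH k.+1 (2 ^ k.+1)%N i.+1 s.-1; rewrite ?expn_gt0//.
  - lia.
  - by rewrite expnS; lia.
  - lia.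
  exists j.+1; split; first lia.
  by rewrite /= -natr1 addrAC; case: s {ge_s lt_s} ks js sj => [|s] ks js sj;
    [lia|rewrite -natr1 ltrD2r].
case: k xk k0 ge_s => [|k] xk k0 ge_s.
  by rewrite expr0 invr1 x1 in xk.
rewrite expnS in ge_s k0; have k1 : (0 < 2 ^ k)%N by rewrite expn_gt0.
suff [j [js sj]] : exists j, (j <= s.-1)%N /\
    s.-1%:R < j%:R + nth 0 (if r is 0 then
      hire_from n i.+1 (2 * 2 ^- k.+1) (1 / (2 * 2 ^- k.+1)) xs
      else hire_from n i.+1 (2 ^- k.+1) r%:R xs) j.
  exists j.+1; split; first lia.
  by rewrite /= -natr1 addrAC; case: s {lt_s} ge_s js sj => [|s] ge_s js sj;
    [lia|rewrite -natr1 ltrD2r].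
case: r ge_s => [|r] ge_s.
  rewrite mul2_expr2V div1_expr2V.
  by apply: IH; rewrite ?expn_gt0//; lia.
by apply: IH; rewrite ?expnS//; lia.
Qed.

Lemma online_algorithm1 :
  online_algorithm (`[0, 1] : set R) (@algorithm1 R).
Proof.
move=> n; split=> [x y i xy|x x01].
  apply: nth_hire_from_causal; first by rewrite !size_codom.
  apply: (@eq_from_nth _ 0) => [|m]; first by rewrite !size_take !size_codom.
  rewrite size_take size_codom card_ord => m_lt.
  have mn : (m < n)%N by move: m_lt; case: ifP => // ? ?; lia.
  have mi : (m <= i)%N by move: m_lt; case: ifP => // ? ?; lia.
  rewrite !nth_take// !(nth_map (Ordinal mn)) -?enumT ?size_enum_ord//.
  by apply: xy; rewrite nth_enum_ord.
have x1 : all (<= 1) (codom x).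
  by apply/allP => _ /codomP[j ->]; have := x01 j; rewrite /= in_itv => /andP[].
have E : hire_from n 1 1 1 (codom x) = hire_from n 1 (2 ^- 0) 1%:R (codom x).
  by rewrite expr0 invr1.
split=> [i|s]; rewrite /algorithm1 E; first exact: hire_from_nat.
have [|||j [js sj]] := @hire_from_covers n 1 0 1 (codom x) s isT x1.
- by rewrite size_codom card_ord addn1.
- by rewrite addn2.
- by rewrite size_codom card_ord.
have jn : (j < n)%N by apply: leq_ltn_trans js _.
by exists (Ordinal jn).
Qed.
End Deterministic.

(** * Lower bounds on the offline optimum for fixed costs *)

Section Optimum.
Context {R : realType}.
Variable n : nat.
Implicit Types (x t l : 'I_n -> R).

(** The first applicant alone covers everything, so the surplus [a] is free; [opt_ge0] uses it to
    drive the cost to minus infinity. *)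
Lemma feasible_hire_first (a : 'I_n -> nat) :
  feasible (fun j => ((j == 0 :> nat) * n + a j)%:R : R).
Proof.
split=> [i|s]; first by rewrite natr_nat.
have n0 : (0 < n)%N by exact: leq_ltn_trans (ltn_ord s).
exists (Ordinal n0); split=> //=.
by rewrite add0r ltr_nat mul1n ltn_addr.
Qed.

(** Double counting: every step s has a covering applicant, of cost at least [l s], and applicant i
    covers at most [t i] steps. *)
Lemma cost_ge_sum_lower x t l : (forall i, 0 <= x i) -> feasible t ->
  (forall i s : 'I_n, (i <= s)%N -> l s <= x i) ->
  \sum_(s < n) l s <= cost x t.
Proof.
move=> x0 [tN tcov] lx.
apply: (@le_trans _ _
  (\sum_(s < n) \sum_(i < n | (i <= s)%N && (s%:R < i%:R + t i)) x i)).
  apply: ler_sum => s _; have [i [le_is lt_s]] := tcov s.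
  rewrite (bigD1 i) ?le_is//= -[l s]addr0 lerD ?lx// sumr_ge0//.
rewrite (exchange_big_dep xpredT)//= /cost.
apply: ler_sum => i _.
have /natrP[m tm] := tN i; rewrite {}tm.
under eq_bigl do rewrite -natrD ltr_nat.
rewrite sumr_const -[_ *+ _]mulr_natl ler_wpM2r// ler_nat.
rewrite cardE -(size_map val) -(size_iota i m).
apply: uniq_leq_size; first by rewrite map_inj_uniq ?enum_uniq//; exact: val_inj.
by move=> y /mapP[s + ->]; rewrite mem_enum mem_iota size_iota.
Qed.

Lemma opt_ge_sum_lower x l : (forall i, 0 <= x i) ->
  (forall i s : 'I_n, (i <= s)%N -> l s <= x i) ->
  \sum_(s < n) l s <= opt x.
Proof.
move=> x0 lx; apply: lb_le_inf.
  by exists (cost x (fun j => ((j == 0 :> nat) * n + 0)%:R)),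
    (fun j => ((j == 0 :> nat) * n + 0)%:R); first exact: feasible_hire_first.
by move=> _ [t ft <-]; exact: cost_ge_sum_lower.
Qed.

(* With a negative cost the feasible costs are unbounded below and the infimum *)
(* takes its junk value 0.                                                     *)
Lemma opt_ge0 x : 0 <= opt x.
Proof.
have [/forallP x0|/forallPn[i]] := boolP [forall i, 0 <= x i].
  have := @opt_ge_sum_lower x (fun=> 0) x0 (fun i s _ => x0 i).
  by rewrite big1_eq.
rewrite -ltNge => xi0; rewrite /opt inf_out// => -[_ [b blb]].
pose F := \sum_(j < n) ((j == 0 :> nat) * n)%:R * x j.
have lbF K : b <= F + K%:R * x i.
  apply: blb; exists (fun j => ((j == 0 :> nat) * n + (j == i) * K)%:R).
    exact: feasible_hire_first.
  rewrite /cost /F; under eq_bigr do rewrite natrD mulrDl.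
  rewrite big_split/=; congr +%R.
  rewrite (bigD1 i)//= eqxx mul1n big1 ?addr0// => j /eqP ji.
  by case: eqP => [/val_inj/ji|_]; rewrite ?mul0n ?mul0r.
have Nxi : 0 < - x i by rewrite oppr_gt0.
have := lbF (Num.truncn ((F - b) / - x i)).+1.
set K := (Num.truncn _).+1.
have : (F - b) / - x i < K%:R by rewrite truncnS_gt.
rewrite ltr_pdivrMr//; lra.
Qed.
End Optimum.

(** * Numerical estimates for 1/e and harmonic sums *)

Section Numerics.
Context {R : realType}.

Lemma exprB1V_le m : (0 < m)%N -> (1 - m%:R^-1 : R) ^+ m <= 3 / 8.
Proof.
move=> m0; have mV : (m%:R^-1 : R) <= 1 by rewrite invf_le1 ?ltr0n ?ler1n.
apply: (@le_trans _ _ (expR (- m%:R^-1) ^+ m)).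
  by apply: lerXn2r; rewrite ?nnegrE ?subr_ge0 ?expR_ge0// expR_ge1Dx.
rewrite -expRM_natl mulrN divff ?pnatr_eq0 -?lt0n// expRN.
rewrite -[_ / _]invrK lef_pV2 ?posrE ?expR_gt0 ?invr_gt0 ?divr_gt0//.
(* 32 is the least power of two m for which (1 + 1/m)^m reaches 8/3. The fractions below bound its
   iterated squares from below. *)
apply: (@le_trans _ _ ((1 + 32^-1) ^+ 32)).
  have sqr (a b : R) j : 0 <= b -> b <= a ^+ j -> b ^+ 2 <= a ^+ (j * 2).
    by move=> b0 ba; rewrite exprM ler_sqr ?nnegrE// (le_trans b0).
  have y2 : 1089 / 1024 <= (1 + 32^-1 : R) ^+ 2 by lra.
  move: (1 + 32^-1 : R) y2 => y y2.
  have y4 : 95 / 84 <= y ^+ 4.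
    by apply: le_trans (sqr _ _ _ _ y2); lra.
  have y8 : 78 / 61 <= y ^+ 8.
    by apply: le_trans (sqr _ _ _ _ y4); lra.
  have y16 : 49 / 30 <= y ^+ 16.
    by apply: le_trans (sqr _ _ _ _ y8); lra.
  by apply: le_trans (sqr _ _ _ _ y16); lra.
have -> : expR 1 = expR 32^-1 ^+ 32 :> R by rewrite -expRM_natl divff.
apply: lerXn2r; rewrite ?nnegrE ?expR_ge0//.
exact: expR_ge1Dx.
Qed.

(** The harmonic number of index n + 1, minus 1. *)
Let h n : R := \sum_(s < n) s.+2%:R^-1.

Let h0 : h 0 = 0. Proof. by rewrite /h big_ord0. Qed.

Let hS n : h n.+1 = h n + n.+2%:R^-1. Proof. by rewrite /h big_ord_recr. Qed.

Let h_mono m n : (m <= n)%N -> h m <= h n.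
Proof.
move=> /subnKC <-; elim: (n - m)%N => [|j IH]; first by rewrite addn0.
by rewrite addnS hS (le_trans IH)// lerDl invr_ge0.
Qed.

(** Rounding each term down to a multiple of 1/N turns numerical bounds into computations on natural
    numbers. *)
Let h_ge N m n c : (0 < N)%N -> (m <= n)%N ->
  (c <= sumn [seq N %/ s.+2 | s <- index_iota m n])%N ->
  c%:R / N%:R <= h n - h m.
Proof.
move=> N0 mn; rewrite -(subnKC mn) /index_iota addKn.
elim: (n - m)%N c => [|j IH] c.
  by rewrite addn0 subrr leqn0 => /eqP ->; rewrite mul0r.
rewrite -[in iota _ _]addn1 iotaD map_cat sumn_cat /= addn0 addnS hS => c_le.
have {}IH := IH _ (leqnn _).
have cle : (c%:R : R) <= (sumn [seq (N %/ s.+2)%N | s <- iota m j])%:R +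
    (N %/ (m + j).+2)%N%:R by rewrite -natrD ler_nat.
apply: (@le_trans _ _ (((sumn [seq (N %/ s.+2)%N | s <- iota m j])%:R +
    (N %/ (m + j).+2)%N%:R) / N%:R)); first by rewrite ler_wpM2r ?invr_ge0.
rewrite mulrDl addrAC lerD// ler_pdivrMr ?ltr0n// mulrC ler_pdivlMr//.
by rewrite -natrM ler_nat leq_trunc_div.
Qed.

(** The constant is 5/8.122. The difference is nondecreasing in m, since 1/(2m + 3) + 1/(2m + 4) >=
    1/(m + 3), so m = 16 suffices. *)
Let h_double m : (16 <= m)%N -> 2500 / 4061 <= h (m.*2.+1) - h m.+1.
Proof.
move=> /subnKC <-; elim: (m - 16)%N => [|j].
  have := @h_ge 2000 17 33 1236 isT isT isT; rewrite addn0.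
  by apply: le_trans; lra.
move=> /le_trans; apply; rewrite addnS; move: (16 + j)%N => {j} {}m.
rewrite doubleS !hS -subr_ge0.
set y := m%:R : R; have y0 : 0 <= y by rewrite /y ler0n.
have -> : (m.*2.+1.+2%:R : R) = 2 * y + 3.
  by rewrite -muln2 -addn3 natrD natrM mulrC.
have -> : (m.*2.+2.+2%:R : R) = 2 * (y + 2).
  by rewrite -muln2 -addn4 natrD natrM /y; ring.
have -> : (m.+1.+2%:R : R) = y + 3 by rewrite -addn3 natrD.
rewrite (_ : _ - _ = (2 * y + 3)^-1 + (2 * (y + 2))^-1 - (y + 3)^-1); last by ring.
rewrite subr_ge0 -[leLHS]mul1r ler_pdivrMr; last by lra.
have -> : ((2 * y + 3)^-1 + (2 * (y + 2))^-1) * (y + 3) =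
   1 + (5 * y + 9) / (2 * (2 * y + 3) * (y + 2)).
  by field; apply/andP; split; lra.
by rewrite lerDl divr_ge0 ?mulr_ge0 ?addr_ge0 ?mulr_ge0.
Qed.

Lemma harmonic_lower K n : (0 < n)%N -> (K == 0 :> nat) || (2 * 2 ^ K < n)%N ->
  5 * K%:R + 2 <= (8 + 122 / 1000) * (\sum_(s < n) s.+2%:R^-1 : R).
Proof.
move=> n0 Kn; rewrite -/(h n).
have h1 : 2^-1 <= h n.
  by rewrite (le_trans _ (h_mono n0))// /h big_ord_recr big_ord0/=; lra.
case: K Kn => [_|K /= Kn]; first by lra.
suff : 5 * K.+1%:R + 2 <= (8 + 122 / 1000) * h (2 * 2 ^ K.+1).+1.
  by move=> /le_trans; apply; apply: ler_wpM2l; [lra|exact: h_mono].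
(* From 9 to 17 terms the sum grows by less than 5/8.122, so levels 1, 2 and 3 are computed
   directly. *)
move=> {Kn}; case: K => [|[|K]].
- by have := @h_ge 2000 0 5 2800 isT isT isT; rewrite h0; lra.
- by have := @h_ge 2000 0 9 3800 isT isT isT; rewrite h0; lra.
elim: K => [|K IH].
  by have := @h_ge 2000 0 17 4800 isT isT isT; rewrite h0; lra.
have : (16 <= 2 * 2 ^ K.+3)%N by rewrite !expnS; have := expn_gt0 2 K; lia.
move=> /h_double; rewrite -muln2 mulnC -expnS -natr1.
by move: IH; set u := h _; set v := h _; lra.
Qed.
End Numerics.

(** * Probabilities of product events *)

Section Boxes.
Context {R : realType} {d : measure_display} {T : measurableType d}
  {P : probability T R} {I : finType}.
Variable X : I -> {RV P >-> R}.
Hypothesis hX : iid_uniform01 X.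
Implicit Types (B : I -> set R) (a : I) (C : set R) (c : R).

Definition box (B : I -> set R) : set T := \bigcap_i (X i @^-1` B i).

Definition set_at (B : I -> set R) a C i := if i == a then C else B i.

Lemma measurable_set_at B a C : (forall i, measurable (B i)) ->
  measurable C -> forall i, measurable (set_at B a C i).
Proof. by move=> mB mC i; rewrite /set_at; case: ifP. Qed.

Lemma measurable_box B : (forall i, measurable (B i)) -> measurable (box B).
Proof.
move=> mB; apply: fin_bigcap_measurable => [|i _]; first exact: finite_finset.
by rewrite -[_ @^-1` _]setTI; exact: measurable_funP.
Qed.

Lemma box_set_at B a C : C `<=` B a ->
  box (set_at B a C) = box B `&` X a @^-1` C.
Proof.
move=> CB; apply/seteqP; split=> w.
  move=> bw; split=> [i _|]; have := bw a Logic.I; rewrite /set_at /= eqxx //.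
  by have := bw i Logic.I; rewrite /set_at/=; case: eqP => [-> _ /CB|].
by move=> [bw Cw] i _; rewrite /set_at /=; case: eqP => [->|_] //; exact: bw.
Qed.

Lemma prob_box B : (forall i, measurable (B i)) ->
  P (box B) = (\prod_i uniform_prob (@ltr01 R) (B i))%E.
Proof.
move=> mB; have [indep unif] := hX.
have := indep [set: I]%SET B mB.
rewrite (_ : [set` [set: I]%SET] = setT); last first.
  by apply/seteqP; split => // i _ /=; rewrite finset.in_setT.
move=> ->; rewrite (eq_bigl xpredT) => [|i]; last by rewrite finset.in_setT.
by apply: eq_bigr => i _; rewrite -(unif i) //; exact: mB.
Qed.

Lemma uniform_prob_sub (C : set R) : measurable C -> C `<=` `[0, 1] ->
  uniform_prob (@ltr01 R) C = lebesgue_measure C.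
Proof.
move=> mC C01; rewrite /uniform_prob.
under eq_integral => x /[!inE] /C01 /=.
  by rewrite in_itv/= /uniform_pdf => ->; rewrite subr0 invr1; over.
by rewrite /= integral_cst// mul1e.
Qed.

Lemma uniform_prob01 : uniform_prob (@ltr01 R) `[0, 1] = 1%E.
Proof. by rewrite uniform_prob_sub// lebesgue_measure_itv/= lte01 oppr0 adde0. Qed.

Lemma uniform_prob_0c c : 0 <= c <= 1 ->
  uniform_prob (@ltr01 R) `[0, c] = c%:E.
Proof.
move=> /andP[c0 c1]; rewrite uniform_prob_sub//; last first.
  by apply: subset_itvl; rewrite bnd_simp.
rewrite lebesgue_measure_itv/= lte_fin oppr0 adde0; case: ltgtP c0 => //.
by move=> <-.
Qed.

Lemma uniform_prob_oc b c : 0 <= b <= c -> c <= 1 ->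
  uniform_prob (@ltr01 R) `]b, c] = (c - b)%:E.
Proof.
move=> /andP[b0 bc] c1; rewrite uniform_prob_sub//; last first.
  by apply: subset_itv; rewrite bnd_simp.
rewrite lebesgue_measure_itv/= lte_fin; case: ltgtP bc => // -> _.
by rewrite subrr.
Qed.

(** Independence of a cost not yet revealed: restricting it to [C] contributes just a factor. *)
Lemma prob_box_set_at B a C : (forall i, measurable (B i)) ->
  B a = `[0, 1]%classic -> measurable C ->
  P (box (set_at B a C)) = (uniform_prob (@ltr01 R) C * P (box B))%E.
Proof.
move=> mB Ba mC; rewrite !prob_box//; last exact: measurable_set_at.
rewrite (bigD1 a)//= [in RHS](bigD1 a)//= Ba uniform_prob01 mul1e.
rewrite /set_at eqxx; congr (_ * _)%E.
by apply: eq_bigr => i /negbTE ->.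
Qed.
End Boxes.

(** * Staircase approximation of integrals by finite sums *)

Section Staircase.
Context {R : realType}.
Implicit Types (h y c e : R) (x : \bar R).

(** A finite layer-cake formula: counting grid points below y from 0 bounds y above, and counting
    from [h] bounds it below ([staircase_le]). Integrals of costs thus reduce to probabilities of
    boxes. *)
Lemma le_staircase h y N : 0 <= h -> y <= h *+ N ->
  y <= \sum_(k < N) h * (h *+ k < y)%R%:R.
Proof.
move=> h0; elim: N => [|N IH] yN; first by rewrite big_ord0.
rewrite big_ord_recr/=; have [yh|hy] := leP y (h *+ N).
  by rewrite mulr0 addr0 IH.
rewrite (eq_bigr (fun=> h)) => [|k _]; last first.
  by rewrite (le_lt_trans _ hy) ?mulr1// ler_wpMn2l// ltnW.
by rewrite sumr_const card_ord mulr1 -mulrSr.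
Qed.

Lemma staircase_le h y N : 0 <= h -> 0 <= y ->
  \sum_(k < N) h * (h *+ k.+1 < y)%R%:R <= y.
Proof.
move=> h0 y0; elim: N => [|N IH]; first by rewrite big_ord0.
rewrite big_ord_recr/=; have [yh|hy] := leP y (h *+ N.+1).
  by rewrite mulr0 addr0 IH.
rewrite mulr1 (le_trans _ (ltW hy))// mulrSr lerD2r.
rewrite -[X in h *+ X]card_ord -sumr_const; apply: ler_sum => k _.
by rewrite ler_piMr// lern1 leq_b1.
Qed.

Lemma sum_arithmetic c h N :
  \sum_(k < N) (c - h *+ k) = N%:R * c - h * N%:R * (N%:R - 1) / 2.
Proof.
elim: N => [|N IH]; first by rewrite big_ord0; ring.
by rewrite big_ord_recr/= IH -natr1 -mulr_natr; field.
Qed.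

Lemma lee_addVnP x c e : 0 <= e ->
  (forall N, (x <= (c + e / N.+1%:R)%:E)%E) -> (x <= c%:E)%E.
Proof.
move=> e0 xc; apply/lee_addgt0Pr => r r0.
pose N := Num.truncn (e / r).
rewrite (le_trans (xc N))// -EFinD lee_fin lerD2l.
by rewrite ler_pdivrMr// mulrC -ler_pdivrMr// ltW// truncnS_gt.
Qed.

Lemma lee_subVnP x c e : 0 <= e ->
  (forall N, ((c - e / N.+1%:R)%:E <= x)%E) -> (c%:E <= x)%E.
Proof.
move=> e0 cx; rewrite -leeN2 -EFinN; apply: (lee_addVnP e0) => N.
by rewrite leeNl -EFinN opprD opprK cx.
Qed.

Lemma integral_staircase (d : measure_display) (T : measurableType d)
    (P : {measure set T -> \bar R}) (J : finType) (S : set T)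
    (E : J -> set T) h :
  0 <= h -> measurable S -> (forall k, measurable (E k)) ->
  (\int[P]_(w in S) (\sum_k h * \1_(E k) w)%:E =
   \sum_k h%:E * P (E k `&` S))%E.
Proof.
move=> h0 mS mE; under eq_integral do rewrite -sumEFin.
rewrite ge0_integral_sum//; last 2 first.
  move=> k; apply/measurable_EFinP; apply: measurable_funM => //.
  by move=> k w _; rewrite lee_fin mulr_ge0.
apply: eq_bigr => k _; under eq_integral do rewrite EFinM.
rewrite ge0_integralZl//; first by rewrite integral_indic.
exact/measurable_EFinP/measurable_indic.
Qed.
End Staircase.

(** * Expected cost of an applicant hired at a given threshold *)

Section BoxIntegral.
Context {R : realType} {d : measure_display} {T : measurableType d}
  {P : probability T R} {I : finType}.
Variable X : I -> {RV P >-> R}.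
Hypothesis hX : iid_uniform01 X.
Implicit Types (B : I -> set R) (a : I) (tau : R).

Lemma integral_box_le B a tau : (forall i, measurable (B i)) ->
  B a = `[0, 1]%classic -> 0 < tau <= 1 ->
  (\int[P]_(w in box X (set_at B a `[0%R, tau])) (X a w)%:E <=
   (tau ^+ 2 / 2)%:E * P (box X B))%E.
Proof.
move=> mB Ba /andP[tau0 tau1].
set S := box X _.
have mS : measurable S by apply: measurable_box; exact: measurable_set_at.
have pfin : P (box X B) \is a fin_num.
  by rewrite fin_num_measure//; exact: measurable_box.
set p := fine (P (box X B)).
have p0 : 0 <= p by rewrite fine_ge0.
rewrite -(fineK pfin) -/p -EFinM.
(* With mesh tau/(N + 1) the upper sum is exactly (tau^2/2) (1 + 1/(N + 1)) p. *)
apply: (@lee_addVnP _ _ _ (tau ^+ 2 / 2 * p)) => [|N].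
  by rewrite mulr_ge0// divr_ge0// exprn_ge0// ltW.
pose h := tau / N.+1%:R.
have h0 : 0 <= h by rewrite divr_ge0 ?ltW.
have hN : h *+ N.+1 = tau by rewrite -mulr_natr divfK.
have hk (k : 'I_N.+1) : h *+ k <= tau by rewrite -hN ler_wpMn2l// ltnW.
pose E (k : 'I_N.+1) := box X (set_at B a `]h *+ k, tau]).
have mE k : measurable (E k).
  by apply: measurable_box; exact: measurable_set_at.
have inSE (k : 'I_N.+1) w : S w -> h *+ k < X a w -> E k w.
  move=> Sw kw i _; have := Sw i Logic.I; rewrite /set_at/=; case: eqP => // ->.
  by rewrite /= !in_itv/= kw => /andP[].
have S0 w : S w -> 0 <= X a w <= tau.
  by move=> /(_ a Logic.I); rewrite /set_at/= eqxx /= in_itv.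
apply: (@le_trans _ _ (\int[P]_(w in S) (\sum_k h * \1_(E k) w)%:E)%E).
  apply: ge0_le_integral => //.
  - by move=> w /S0/andP[? _]; rewrite lee_fin.
  - exact/measurable_EFinP/measurable_funTS.
  - apply/measurable_EFinP; apply: measurable_sum => k.
    by apply: measurable_funM => //; exact: measurable_indic.
  move=> w Sw; have /andP[w0 wt] := S0 w Sw; rewrite lee_fin.
  rewrite (le_trans (@le_staircase _ h _ N.+1 h0 _)) ?hN//.
  apply: ler_sum => k _; rewrite ler_wpM2l// indicE ler_nat.
  have [kw|//] := ltP (h *+ k) (X a w).
  by rewrite mem_set//; exact: inSE.
rewrite integral_staircase//.
apply: (@le_trans _ _ (\sum_(k < N.+1) (h * ((tau - h *+ k) * p))%:E)%E).
  apply: lee_sum => k _; rewrite [leRHS]EFinM lee_wpmul2l ?lee_fin//.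
  suff <- : P (E k) = ((tau - h *+ k) * p)%:E by exact: measureIl.
  rewrite (prob_box_set_at hX)// uniform_prob_oc ?mulrn_wge0// ?hk//.
  by rewrite -(fineK pfin) -EFinM.
rewrite sumEFin lee_fin -mulr_sumr -mulr_suml.
rewrite sum_arithmetic /h -natr1.
have N1 : N%:R + 1 != 0 :> R by rewrite natr1.
by rewrite le_eqVlt; apply/orP; left; apply/eqP; field.
Qed.
End BoxIntegral.

(** * The cost of the algorithm as a recursion, and its potential *)

Section HireCost.
Context {R : realType}.
Implicit Types (tau t x : R) (xs : seq R).

Definition hire_cost n i tau t xs : R :=
  \sum_(p <- zip (hire_from n i tau t xs) xs) p.1 * p.2.

Lemma hire_cost_cons n i tau t x xs : hire_cost n i tau t (x :: xs) =
  if x <= tau then 4 / tau * x +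
    (if n%:R < i%:R + 4 / tau then 0
     else hire_cost n i.+1 (tau / 2) (1 / (tau / 2)) xs)
  else if t - 1 == 0 then hire_cost n i.+1 (2 * tau) (1 / (2 * tau)) xs
  else hire_cost n i.+1 tau (t - 1) xs.
Proof.
rewrite /hire_cost /=; case: ifP => _ /=.
  rewrite big_cons /=; case: ifP => _ //; congr +%R.
  by elim: xs => [|y ys IH] /=; rewrite ?big_nil// big_cons IH mul0r add0r.
by rewrite big_cons mul0r add0r; case: ifP.
Qed.

Lemma hire_cost_dyadic_cons n i k r x xs :
  hire_cost n i (2 ^- k) r.+1%:R (x :: xs) =
  if x <= 2 ^- k then (4 * 2 ^+ k) * x +
    (if (n < i + 4 * 2 ^ k)%N then 0
     else hire_cost n i.+1 (2 ^- k.+1) (2 ^ k.+1)%:R xs)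
  else if r is 0 then hire_cost n i.+1 (2 * 2 ^- k) (1 / (2 * 2 ^- k)) xs
  else hire_cost n i.+1 (2 ^- k) r%:R xs.
Proof.
rewrite hire_cost_cons expr2V div1_expr2V div_expr2V.
have -> : i%:R + 4 * 2 ^+ k = (i + 4 * 2 ^ k)%:R :> R.
  by rewrite natrD natrM natrX.
rewrite ltr_nat -[r.+1%:R]natr1 addrK pnatr_eq0.
by case: r.
Qed.

Lemma hire_cost_ge0 n i tau t xs : 0 < tau -> all (>= 0) xs ->
  0 <= hire_cost n i tau t xs.
Proof.
elim: xs i tau t => [|x xs IH] i tau t tau0.
  by rewrite /hire_cost /= big_nil.
move=> /andP[x0 xs0]; rewrite hire_cost_cons; case: ifP => _.
  apply: addr_ge0; first by rewrite mulr_ge0// divr_ge0// ltW.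
  by case: ifP => // _; apply: IH => //; rewrite divr_gt0.
by case: ifP => _; apply: IH => //; rewrite mulr_gt0.
Qed.

Lemma cost_algorithm1 n (x : 'I_n -> R) :
  cost x (algorithm1 x) = hire_cost n 1 1 1 [seq x j | j <- enum 'I_n].
Proof.
rewrite /hire_cost /cost /algorithm1 /codom /image_mem.
have szh m i tau t xs : size (@hire_from R m i tau t xs) = size xs.
  elim: xs i tau t => //= y ys IH i tau t.
  by do 2 (case: ifP => _ /=); rewrite ?IH ?size_nseq.
set ys := map _ _; set zs := hire_from _ _ _ _ _.
have sz : size zs = size ys by exact: szh.
have sy : size ys = n by rewrite size_map size_enum_ord.
rewrite (big_nth (0, 0)) size_zip sz minnn sy big_mkord.
apply: eq_bigr => i _; rewrite nth_zip//=; congr (_ * _).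
by rewrite (nth_map i) ?size_enum_ord// nth_ord_enum.
Qed.

Lemma measurable_hire_cost (d : measure_display) (T : measurableType d)
    (P : probability T R) (I : finType) (X : I -> {RV P >-> R}) n i tau t s :
  measurable_fun setT (fun w => hire_cost n i tau t [seq X j w | j <- s]).
Proof.
elim: s i tau t => [|a s IH] i tau t /=.
  by rewrite (_ : (fun _ => _) = cst 0)//; apply/funext => w;
    rewrite /hire_cost /= big_nil.
under eq_fun do rewrite hire_cost_cons.
apply: measurable_fun_ifT.
- by apply: measurable_fun_ler => //.
- apply: measurable_funD; first exact: measurable_funM.
  by case: (n%:R < _) => //; exact: IH.
- by case: (t - 1 == 0); exact: IH.
Qed.

(* Upper bound on the expected cost still to be paid in the state              *)
(* [tau = 2 ^- k], [t = r] when a hire at level [K] ends the run: it satisfies *)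
(* V k r = 2^-k (2 + 5 (K - k)) + (1 - 2^-k) V k (r - 1), where a hire costs 2 *)
(* on average and V k 0 = 5 (K + 2 - k) bounds the value of a fresh phase on   *)
(* level k - 1.                                                                *)
Definition hire_potential K k r : R :=
  5 * (K%:R + 1 - k%:R) - 3 + 8 * (1 - 2 ^- k) ^+ r.

Lemma hire_potential_ge K k r : (k <= K)%N -> 2 <= hire_potential K k r.
Proof.
move=> kK; have : (k%:R : R) <= K%:R by rewrite ler_nat.
have : 0 <= (1 - 2 ^- k : R) ^+ r by rewrite exprn_ge0// subr_ge0 expr2V_le1.
rewrite /hire_potential; lra.
Qed.

Lemma hire_potential_fresh K k :
  hire_potential K k (2 ^ k) <= 5 * (K%:R + 1 - k%:R).
Proof.
have := @exprB1V_le R (2 ^ k) (expn_gt0 _ _); rewrite natrX.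
rewrite /hire_potential; lra.
Qed.

Lemma hire_potentialS K k r : hire_potential K k r.+1 =
  2 ^- k * (2 + 5 * (K%:R - k%:R)) + (1 - 2 ^- k) * hire_potential K k r.
Proof. by rewrite /hire_potential exprS; ring. Qed.
End HireCost.

(** * The potential bounds the expected remaining cost *)

Section ExpectedCost.
Context {R : realType} {d : measure_display} {T : measurableType d}
  {P : probability T R} {I : finType}.
Variable X : I -> {RV P >-> R}.
Hypothesis hX : iid_uniform01 X.

(* Conditioning on the past amounts to integrating over a box in which the     *)
(* costs yet to be revealed range over the whole unit interval.                *)
Lemma integral_hire_cost_le K n i k r s (B : I -> set R) :
  (0 < i)%N -> (n <= 4 * 2 ^ K)%N -> (k <= K)%N -> (0 < r)%N -> uniq s ->
  (forall j, measurable (B j)) -> (forall j, j \in s -> B j = `[0, 1]%classic) ->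
  (\int[P]_(w in box X B)
     (hire_cost n i (2 ^- k) r%:R [seq X j w | j <- s])%:E <=
   (hire_potential K k r)%:E * P (box X B))%E.
Proof.
move=> i0 nK; elim: s i k r B i0 => [|a s IH] i k r B i0 kK r0 us mB B01.
  rewrite (_ : (fun _ => _) = cst 0%E); last first.
    by apply/funext => w; rewrite /hire_cost /= big_nil.
  rewrite integral0 mule_ge0// lee_fin.
  by apply: le_trans (hire_potential_ge _ kK).
have /andP[as_ us'] : (a \notin s) && uniq s by [].
have mbox C : measurable C -> measurable (box X (set_at B a C)).
  by move=> mC; apply: measurable_box; exact: measurable_set_at.
have Ba : B a = `[0, 1]%classic by rewrite B01 ?mem_head.
set tau : R := 2 ^- k.
have tau0 : 0 < tau by exact: expr2V_gt0.
have tau1 : tau <= 1 by exact: expr2V_le1.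
have tau01 : 0 <= tau <= 1 by rewrite ltW.
pose S1 := box X (set_at B a `[0, tau]).
pose S2 := box X (set_at B a `]tau, 1]).
have mS1 : measurable S1 by exact: mbox.
have mS2 : measurable S2 by exact: mbox.
have mbB : measurable (box X B) by exact: measurable_box.
have pfin : P (box X B) \is a fin_num by rewrite fin_num_measure.
set p := fine (P (box X B)).
have p0 : 0 <= p by rewrite fine_ge0.
have PB : P (box X B) = p%:E by rewrite fineK.
have PS1 : P S1 = (tau * p)%:E.
  by rewrite (prob_box_set_at hX)// uniform_prob_0c// PB -EFinM.
have PS2 : P S2 = ((1 - tau) * p)%:E.
  by rewrite (prob_box_set_at hX)// uniform_prob_oc// PB -EFinM.
have BS : box X B = S1 `|` S2.
  rewrite /S1 /S2 !box_set_at ?Ba.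
  - rewrite -setIUr setIidl// => w /(_ a Logic.I); rewrite /= Ba /= !in_itv/=.
    by move=> /andP[-> ->]; case: leP => ?; [left|right].
  - by apply: subset_itvr; rewrite bnd_simp ltW.
  - by apply: subset_itvl; rewrite bnd_simp.
have S12 : [disjoint S1 & S2].
  apply/disj_setPS => w [/(_ a Logic.I) + /(_ a Logic.I)].
  rewrite /set_at /= eqxx /= !in_itv/= => /andP[_ wt] /andP[tw _].
  by have := lt_le_trans tw wt; rewrite ltxx.
have B1 C j : j \in s -> set_at B a C j = `[0, 1]%classic.
  move=> js; rewrite /set_at; case: eqP => [ja|_].
    by rewrite ja (negbTE as_) in js.
  by rewrite B01// in_cons js orbT.
have box_ge0 w : box X B w -> all (>= 0) [seq X j w | j <- a :: s].
  move=> Bw; apply/allP => _ /mapP[j js ->]; have := Bw j Logic.I.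
  by rewrite /= B01//= in_itv/= => /andP[].
have mf m t u l D : measurable_fun D
    (fun w => (hire_cost n m t u [seq X j w | j <- l])%:E).
  exact/measurable_EFinP/measurable_funTS/measurable_hire_cost.
case: r r0 => // r _.
rewrite BS ge0_integral_setU//; last first.
  by move=> w; rewrite -BS => Bw; rewrite lee_fin hire_cost_ge0// box_ge0.
rewrite -BS PB -EFinM.
pose g1 w := if (n < i + 4 * 2 ^ k)%N then 0
  else hire_cost n i.+1 (2 ^- k.+1) (2 ^ k.+1)%:R [seq X j w | j <- s].
pose g2 w := if r is 0 then hire_cost n i.+1 (2 * tau) (1 / (2 * tau))
    [seq X j w | j <- s]
  else hire_cost n i.+1 tau r%:R [seq X j w | j <- s].
have SB1 : S1 `<=` box X B by rewrite BS; exact: subsetUl.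
have E1 : (\int[P]_(w in S1) (g1 w)%:E <= (5 * (K%:R - k%:R) * (tau * p))%:E)%E.
  rewrite /g1; case: (boolP (n < _)%N) => [_|go_on].
    by rewrite integral0 lee_fin !mulr_ge0 ?subr_ge0 ?ler_nat// ltW.
  (* A hire at level K ends the run, because n <= 4 * 2^K < i + 4 * 2^K. *)
  have kK' : (k < K)%N.
    rewrite ltn_neqAle kK andbT; apply: contraNneq go_on => ->.
    by rewrite (leq_ltn_trans nK)// -[ltnLHS]add0n ltn_add2r.
  rewrite EFinM -PS1; apply: le_trans.
    apply: IH => //; first by rewrite expn_gt0.
      exact: measurable_set_at.
    by move=> j /B1 ->.
  rewrite lee_wpmul2r// lee_fin (le_trans (hire_potential_fresh _ _))//.
  by rewrite -natr1; lra.
have E2 : (\int[P]_(w in S2) (g2 w)%:E <=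
    (hire_potential K k r * ((1 - tau) * p))%:E)%E.
  rewrite EFinM -PS2 /g2 {g2}; case: r => [|r'].
    have [k0|k0] := posnP k.
      (* A rejection at threshold 1 is a null event, so level 0 is never left downwards. *)
      have PS20 : P S2 = 0%E by rewrite PS2 /tau k0 expr0 invr1 subrr mul0r.
      by rewrite null_set_integral// PS20 mule0.
    rewrite /tau -(prednK k0) mul2_expr2V div1_expr2V; apply: le_trans.
      apply: IH => //; first lia; first by rewrite expn_gt0.
        exact: measurable_set_at.
      by move=> j /B1 ->.
    rewrite lee_wpmul2r// lee_fin (le_trans (hire_potential_fresh _ _))//.
    by rewrite /hire_potential expr0 -natr1; lra.
  apply: IH => //; first exact: measurable_set_at.
  by move=> j /B1 ->.
have -> : (\int[P]_(w in S2)
    (hire_cost n i tau r.+1%:R [seq X j w | j <- a :: s])%:E =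
    \int[P]_(w in S2) (g2 w)%:E)%E.
  apply: eq_integral => w /[!inE] /(_ a Logic.I).
  rewrite /set_at /= eqxx /= in_itv/= => /andP[tw _].
  by rewrite hire_cost_dyadic_cons leNgt tw.
have -> : (\int[P]_(w in S1)
    (hire_cost n i tau r.+1%:R [seq X j w | j <- a :: s])%:E =
    \int[P]_(w in S1) ((4 * 2 ^+ k)%:E * (X a w)%:E + (g1 w)%:E))%E.
  apply: eq_integral => w /[!inE] /(_ a Logic.I).
  rewrite /set_at /= eqxx /= in_itv/= => /andP[_ wt].
  by rewrite hire_cost_dyadic_cons wt EFinD EFinM.
have X0 w : S1 w -> (0 <= (X a w)%:E)%E.
  move=> /(_ a Logic.I).
  by rewrite /set_at /= eqxx /= in_itv/= lee_fin => /andP[].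
have mX : measurable_fun S1 (fun w => (X a w)%:E).
  exact/measurable_EFinP/measurable_funTS.
rewrite ge0_integralD//; last 4 first.
- by move=> w /X0 Xw; rewrite mule_ge0// lee_fin mulr_ge0// exprn_ge0.
- by apply: emeasurable_funM.
- move=> w /SB1 /box_ge0 /andP[_ sw]; rewrite lee_fin /g1; case: ifP => // _.
  by rewrite hire_cost_ge0// expr2V_gt0.
- by rewrite /g1; case: (n < _)%N => //; exact: mf.
rewrite ge0_integralZl//.
have E0 := @integral_box_le _ _ _ _ _ X hX B a tau mB Ba.
apply: (@le_trans _ _ ((4 * 2 ^+ k)%:E * (tau ^+ 2 / 2 * p)%:E +
    (5 * (K%:R - k%:R) * (tau * p))%:E +
    (hire_potential K k r * ((1 - tau) * p))%:E)%E).
  rewrite leeD// leeD//.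
  rewrite lee_wpmul2l ?lee_fin ?mulr_ge0 ?exprn_ge0//.
  by rewrite EFinM -PB; apply: E0; rewrite tau0.
rewrite -EFinM -!EFinD lee_fin hire_potentialS -/tau le_eqVlt.
apply/orP; left; apply/eqP.
(* As [2 ^+ k * tau] is 1, the hire contributes 2 on an event of probability [tau * p]. *)
have -> : 4 * 2 ^+ k * (tau ^+ 2 / 2 * p) = 2 ^+ k * tau * (2 * tau * p).
  by field.
by rewrite /tau divff ?expf_neq0//; ring.
Qed.
End ExpectedCost.

(** * Expected running minimum and expected optimum *)

Section ExpectedOptimum.
Context {R : realType}.

(** Mean value bound for powers; it makes the Riemann sum below telescope. *)
Lemma exprBS_le (a b : R) m : 0 <= b -> b <= a ->
  a ^+ m.+1 - b ^+ m.+1 <= m.+1%:R * (a - b) * a ^+ m.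
Proof.
move=> b0 ba; elim: m => [|m IH]; first by rewrite !expr1 expr0; lra.
have bam : b ^+ m.+1 <= a ^+ m.+1 by rewrite lerXn2r ?nnegrE// (le_trans b0).
have a0 : 0 <= a by exact: le_trans ba.
have -> : a ^+ m.+2 - b ^+ m.+2 =
    a * (a ^+ m.+1 - b ^+ m.+1) + (a - b) * b ^+ m.+1.
  by rewrite [a ^+ m.+2]exprS [b ^+ m.+2]exprS; ring.
have -> : m.+2%:R * (a - b) * a ^+ m.+1 =
    a * (m.+1%:R * (a - b) * a ^+ m) + (a - b) * a ^+ m.+1.
  by rewrite -[m.+2%:R]natr1 exprS; ring.
by rewrite lerD// ler_wpM2l// subr_ge0.
Qed.

(** A lower sum for the integral of (1 - y)^m over the unit interval, which is 1/(m + 1). The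
    left-endpoint sum in [part] dominates the integral; passing to right endpoints loses at most its
    first term, one mesh. *)
Lemma power_riemann_sum_ge N m : m.+1%:R^-1 - N.+1%:R^-1 <=
  \sum_(k < N.+1) N.+1%:R^-1 * (1 - N.+1%:R^-1 *+ k.+1 : R) ^+ m.
Proof.
set h : R := N.+1%:R^-1; pose y k : R := 1 - h *+ k.
have h0 : 0 <= h by rewrite invr_ge0.
have hN : h *+ N.+1 = 1 by rewrite -mulr_natr mulVf.
have y0 k : (k <= N.+1)%N -> 0 <= y k.
  by move=> kN; rewrite subr_ge0 -hN ler_wpMn2l.
have part j : (j <= N.+1)%N ->
    1 - y j ^+ m.+1 <= m.+1%:R * \sum_(k < j) h * y k ^+ m.
  elim: j => [_|j IH jN].
    by rewrite big_ord0 mulr0 /y mulr0n subr0 expr1n subrr.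
  have yS : y j - y j.+1 = h by rewrite /y mulrSr; ring.
  have := @exprBS_le (y j) (y j.+1) m (y0 _ jN).
  rewrite -subr_ge0 yS => /(_ h0); rewrite big_ord_recr/= mulrDr mulrA.
  by have := IH (ltnW jN); lra.
have := part N.+1 (leqnn _).
have -> : y N.+1 = 0 by rewrite /y hN subrr.
rewrite expr0n/= subr0 mulrC -ler_pdivrMr// div1r lerBlDl => /le_trans; apply.
rewrite -(big_mkord xpredT (fun k => h * y k ^+ m)) big_nat_recl//.
rewrite {1}/y mulr0n subr0 expr1n mulr1 lerD2l big_mkord big_ord_recr/=.
by rewrite lerDl mulr_ge0// exprn_ge0// y0.
Qed.

Context {d : measure_display} {T : measurableType d} {P : probability T R}.

(** Used to compare with [opt], whose measurability is never established: the integral is a supremum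
    over simple functions below the integrand, hence monotone. *)
Lemma ge0_le_integralT (f g : T -> \bar R) : (forall w, 0 <= f w)%E ->
  (forall w, f w <= g w)%E -> (\int[P]_w f w <= \int[P]_w g w)%E.
Proof.
move=> f0 fg; rewrite !ge0_integralTE//; last first.
  by move=> w; rewrite (le_trans (f0 w)).
apply: le_ereal_sup => _ [u uf <-]; exists u => // w.
by rewrite (le_trans (uf w)).
Qed.

Variables (n : nat) (X : 'I_n -> {RV P >-> R}).
Hypothesis hX : iid_uniform01 X.

(** On [E (s, k)] the first s + 1 costs all exceed h (k + 1). Summing over k gives a staircase below
    the running minimum, whose expectation is a Riemann sum for 1/(s + 2); each of the n steps loses
    at most one mesh. *)
Lemma expected_opt_ge :
  ((\sum_(s < n) s.+2%:R^-1)%:E <= 'E_P[fun w => opt (X ^~ w)])%E.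
Proof.
rewrite expectation.unlock; apply: (@lee_subVnP _ _ _ n%:R) => // N.
set h : R := N.+1%:R^-1.
have h0 : 0 <= h by rewrite invr_ge0.
have hN : h *+ N.+1 = 1 by rewrite -mulr_natr mulVf.
pose B (sk : 'I_n * 'I_N.+1) (i : 'I_n) : set R :=
  if (i <= sk.1)%N then `]h *+ sk.2.+1, 1]%classic else `[0, 1]%classic.
have mB sk i : measurable (B sk i) by rewrite /B; case: ifP.
pose E sk := box X (B sk).
have mE sk : measurable (E sk) by exact: measurable_box.
have hk (k : 'I_N.+1) : 0 <= h *+ k.+1 <= 1.
  by rewrite mulrn_wge0//= -hN ler_wpMn2l.
have PE sk : P (E sk) = ((1 - h *+ sk.2.+1) ^+ sk.1.+1)%:E.
  rewrite (prob_box hX)//.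
  rewrite (eq_bigr (fun i : 'I_n =>
    (if (i < sk.1.+1)%N then 1 - h *+ sk.2.+1 else 1)%:E)) => [|i _]; last first.
    rewrite /B ltnS; case: ifP => _; last exact: uniform_prob01.
    by rewrite uniform_prob_oc.
  rewrite -(big_morph EFin (@EFinM R) erefl) -big_mkcond/=.
  by rewrite (big_ord_narrow (ltn_ord sk.1)) prodr_const card_ord.
apply: (@le_trans _ _ (\int[P]_w (\sum_sk h * \1_(E sk) w)%:E)%E); last first.
  apply: ge0_le_integralT => w.
    by rewrite lee_fin sumr_ge0// => sk _; rewrite mulr_ge0.
  rewrite lee_fin; have [x0|/existsNP[j xj]] := pselect (forall i, 0 <= X i w).
    rewrite -(pair_big xpredT xpredT (fun s k => h * \1_(E (s, k)) w))/=.
    apply: opt_ge_sum_lower => // i s le_is.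
    apply: le_trans (staircase_le N.+1 h0 (x0 i)).
    apply: ler_sum => k _; rewrite ler_wpM2l// indicE ler_nat.
    case: (boolP (w \in _)) => // /[!inE] /(_ i Logic.I).
    by rewrite /B /= le_is /= in_itv/= => /andP[-> _].
  (* A sample point with a negative cost lies in no box, so the staircase vanishes there. *)
  rewrite big1 ?opt_ge0// => sk _; rewrite indicE memNset ?mulr0//.
  move=> /(_ j Logic.I) /=; rewrite /B; case: ifP => _ /=;
    rewrite in_itv/= => /andP[xj0 _]; apply: xj => //.
  by apply: le_trans (ltW xj0); have /andP[] := hk sk.2.
rewrite integral_staircase//.
rewrite (eq_bigr (fun sk : 'I_n * 'I_N.+1 =>
    (h * (1 - h *+ sk.2.+1) ^+ sk.1.+1)%:E)); last first.
  by move=> sk _; rewrite setIT EFinM; congr (_ * _)%E; exact: PE.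
rewrite sumEFin lee_fin.
rewrite -(pair_big xpredT xpredT
  (fun (s : 'I_n) (k : 'I_N.+1) => h * (1 - h *+ k.+1) ^+ s.+1))/=.
have -> : n%:R * h = \sum_(s < n) h.
  by rewrite sumr_const card_ord mulr_natl.
rewrite -sumrB; apply: ler_sum => s _; exact: power_riemann_sum_ge.
Qed.
End ExpectedOptimum.

(** * Expected cost from the initial state *)

Section ExpectedAlgorithm.
Context {R : realType} {d : measure_display} {T : measurableType d}
  {P : probability T R}.
Variables (n : nat) (X : 'I_n -> {RV P >-> R}).
Hypothesis hX : iid_uniform01 X.

Lemma expected_algorithm1_le K : (n <= 4 * 2 ^ K)%N ->
  ('E_P[fun w => cost (X ^~ w) (algorithm1 (X ^~ w))] <=
   (5 * K%:R + 2)%:E)%E.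
Proof.
move=> nK; rewrite expectation.unlock.
under eq_integral do rewrite cost_algorithm1.
pose S := box X (fun=> `[0, 1]%classic).
have mS : measurable S by apply: measurable_box => i; exact: measurable_itv.
have PS : P S = 1%E.
  rewrite (prob_box hX); last by move=> i; exact: measurable_itv.
  by rewrite big1// => i _; exact: uniform_prob01.
have PCS : P (~` S) = 0%E by rewrite probability_setC// PS subee.
have mf D : measurable_fun D
    (fun w => (hire_cost n 1 1 1 [seq X j w | j <- enum 'I_n])%:E).
  exact/measurable_EFinP/measurable_funTS/measurable_hire_cost.
have mCS : measurable (~` S) by exact: measurableC.
rewrite -(setUv S) integral_setU//; last first.
  by apply/disj_setPS; rewrite setICr.
rewrite [X in (_ + X)%E]null_set_integral// adde0.
have := @integral_hire_cost_le _ _ _ _ _ X hX K n 1 0 1 (enum 'I_n)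
  (fun=> `[0, 1]%classic) isT nK (leq0n _) isT (enum_uniq _).
rewrite -/S PS mule1 expr0 invr1 => /(_ _ _)/le_trans; apply => //.
(* In the initial state k = 0, r = 1 the power vanishes and the potential is 5 K + 2. *)
by rewrite lee_fin /hire_potential expr0 invr1 subrr expr1; lra.
Qed.
End ExpectedAlgorithm.

Theorem theorem4p3 (R : realType) (d : nat -> measure_display)
    (T : forall n : nat, measurableType (d n))
    (P : forall n : nat, probability (T n) R)
    (X : forall n : nat, 'I_n -> {RV (P n) >-> R})
    (hX : forall n : nat, iid_uniform01 (X n)) :
  online_algorithm (`[0, 1] : set R) (@algorithm1 R) /\
  strictly_competitive X (8 + 122 / 1000) (@algorithm1 R).
Proof.
split; first exact: online_algorithm1.
apply: ge_ereal_sup => _ [n /= n0 <-].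
(* The least such K: minimality makes n large enough for the harmonic bound. *)
have [K nK Kn] : exists2 K, (n <= 4 * 2 ^ K)%N &
    (K == 0 :> nat) || (2 * 2 ^ K < n)%N.
  have exK : exists K, (n <= 4 * 2 ^ K)%N.
    by exists n; have := ltn_expl n (isT : 1 < 2)%N; lia.
  case: (ex_minnP exK) => -[|K] nK minK; first by exists 0%N.
  exists K.+1 => //=; rewrite ltnNge; apply/negP => nK'.
  by have := minK K; rewrite expnS in nK'; lia.
set L : R := \sum_(s < n) s.+2%:R^-1.
have AL : 5 * K%:R + 2 <= (8 + 122 / 1000) * L by exact: harmonic_lower.
have L0 : 0 < L.
  have : 0 <= (K%:R : R) by [].
  by move: AL; lra.
have optL := expected_opt_ge (hX n).
have algK := expected_algorithm1_le (hX n) nK.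
set opt_ := expectation _ _ in optL *.
have opt0 : (0 <= opt_)%E by apply: le_trans optL; rewrite lee_fin ltW.
have inv_opt : (opt_^-1 <= L^-1%:E)%E.
  have LV : L^-1%:E = (L%:E)^-1%E by rewrite inver gt_eqF.
  by rewrite LV lee_pV2// inE lee_fin ltW.
apply: le_trans (lee_wpmul2r _ algK) _; first by rewrite inve_ge0.
apply: le_trans (lee_wpmul2l _ inv_opt) _; first by rewrite lee_fin addr_ge0 ?mulr_ge0.
by rewrite -EFinM lee_fin ler_pdivrMr.
Qed.
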